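(* Let $k\geq 2$ be an integer and let $G$ be a finite nilpotent group. Then $G$ is totally $k$-closed if and only if every Sylow subgroup of $G$ is totally $k$-closed.
   Context: Let $k$ be a positive integer. For a permutation group $G\leq \mathrm{Sym}(\Omega)$ on a set $\Omega$, the $k$-closure $G^{(k)}$ of $G$ is the group of all permutations $g\in\mathrm{Sym}(\Omega)$ that preserve (setwise) each $G$-orbit in the induced (coordinatewise) action of $G$ on the set $\Omega^k=\Omega\times\dots\times\Omega$ of ordered $k$-tuples. A permutation group $G$ is $k$-closed if $G^{(k)}=G$. An abstract group $G$ is totally $k$-closed if, for every faithful permutation representation of $G$ on a set $\Omega$, the image of $G$ in $\mathrm{Sym}(\Omega)$ is $k$-closed. *)

(* Defs.v *)
(* Mathematical Components, with classical sets from MathComp-Analysis. *)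
From mathcomp Require Import all_boot all_fingroup all_solvable.
From mathcomp Require Import boolp classical_sets.

Set Implicit Arguments.
Unset Strict Implicit.
Unset Printing Implicit Defensive.

Local Open Scope classical_set_scope.

Section KClosure.

Variables (Omega : Type) (k : nat).

(* A permutation group on Omega, which may be infinite and need not have
   decidable equality, is represented by the set of its elements, viewed as
   functions Omega -> Omega. *)
Implicit Type H : set (Omega -> Omega).

Definition tuple_orbit H (t : k.-tuple Omega) : set (k.-tuple Omega) :=
  [set map_tuple h t | h in H].

Definition k_closure H : set (Omega -> Omega) :=
  [set g | bijective g /\
    forall t, [set map_tuple g s | s in tuple_orbit H t] = tuple_orbit H t].

Definition k_closed H : Prop := k_closure H = H.

End KClosure.

Section TotallyKClosed.

Variables (gT : finGroupType) (G : {group gT}).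

(* The library's [faithful _, on _ | _] requires a finite Omega. Only the
   restriction to G of a function of type action G Omega is a representation;
   its values outside G are irrelevant. *)
Definition faithful_action (Omega : Type) (to : action G Omega) : Prop :=
  forall a, a \in G -> (forall x, to x a = x) -> a = 1%g.

Definition action_image (Omega : Type) (to : action G Omega) :
    set (Omega -> Omega) :=
  [set (fun x => to x a) | a in [set a | a \in G]].

Definition totally_k_closed (k : nat) : Prop :=
  forall (Omega : Type) (to : action G Omega),
    faithful_action to -> k_closed k (action_image to).

End TotallyKClosed.

(* Main.v *)
Require Import Defs.
From mathcomp Require Import boolp classical_sets.
From mathcomp Require Import all_boot all_fingroup all_solvable.

Set Implicit Arguments.
Unset Strict Implicit.
Unset Printing Implicit Defensive.

Local Open Scope group_scope.

(** The k-closure of a group consists of the permutations that agree with some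
    group element on any k given points, and for k >= 2 a map with this
    property is automatically a permutation: on two points it is injective,
    and it preserves the orbits, which are finite. So total k-closure says
    that in every faithful action each such map is given by a single group
    element.

    If G is the direct product of P and H, and P acts faithfully on Omega,
    then G acts faithfully on the disjoint union of Omega and a set on which
    H acts freely. A map on Omega that agrees k-locally with P extends by the identity
    to one that agrees k-locally with G, so P inherits total k-closure from G
    ([totally_k_closed_factor]).

    Conversely let P and H have coprime orders, let G act on Omega, and let g
    agree k-locally with G. If g moves x as u * v does, with u in P and v in
    H, then the image of x under u depends only on x and g: by coprimality, a
    point stabiliser in G contains the P-component of each of its elements
    ([stab_component]). So g has a P-component, which agrees k-locally with P
    and hence is an element a of P; likewise g has an H-component b, and g is
    the action of a * b ([totally_k_closed_dprod]).

    A nilpotent group is the direct product of 'O_p and 'O_p^' for every prime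
    p, and its Sylow subgroups are the 'O_p, so the theorem follows by
    induction on the order. *)

(** * Actions on arbitrary types *)

Section Actions.

Variables (gT : finGroupType) (G : {group gT}) (Omega : Type).
Variable to : action G Omega.

Lemma action_inj a : injective (to^~ a).
Proof. by case: to => act []. Qed.

Lemma actionM x : {in G &, forall a b, to x (a * b) = to (to x a) b}.
Proof. by case: to => act [? actM] a b aG bG; apply: actM. Qed.

Lemma action1 x : to x 1 = x.
Proof. by apply: (@action_inj 1); rewrite -actionM ?group1 ?mulg1. Qed.

Lemma actionK a : a \in G -> cancel (to^~ a) (to^~ a^-1).
Proof. by move=> aG x; rewrite -actionM ?groupV // mulgV action1. Qed.

Lemma actionVK a : a \in G -> cancel (to^~ a^-1) (to^~ a).
Proof. by move=> aG x; rewrite -actionM ?groupV // mulVg action1. Qed.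

Lemma action_bijective a : a \in G -> bijective (to^~ a).
Proof. by exists (to^~ a^-1); [apply: actionK | apply: actionVK]. Qed.

Lemma restrict_is_action (P : {group gT}) : P \subset G -> is_action P to.
Proof.
move=> /subsetP sPG; split=> [|x a b aP bP]; first exact: action_inj.
by rewrite actionM ?sPG.
Qed.

Definition restrict_action (P : {group gT}) (sPG : P \subset G) :
  action P Omega := Action (restrict_is_action sPG).

End Actions.

(** * Total k-closure in terms of local agreement *)

Definition locally_in (gT : finGroupType) (G : {group gT}) (k : nat)
    (Omega : Type) (to : action G Omega) (g : Omega -> Omega) : Prop :=
  forall w : 'I_k -> Omega,
    exists2 a, a \in G & forall i, g (w i) = to (w i) a.

Section Local.

Variables (gT : finGroupType) (G : {group gT}) (k : nat).
Variables (Omega : Type) (to : action G Omega).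

Lemma locally_in1 g x :
  0 < k -> locally_in k to g -> exists2 a, a \in G & g x = to x a.
Proof.
move=> k_gt0 /(_ (fun=> x)) [a aG ga].
by exists a => //; apply: ga (Ordinal k_gt0).
Qed.

Lemma locally_in2 g x y : 1 < k -> locally_in k to g ->
  exists a, [/\ a \in G, g x = to x a & g y = to y a].
Proof.
move=> k_gt1 /(_ (fun i => if i == 0 :> nat then x else y)) [a aG ga].
exists a; split=> //; first exact: (ga (Ordinal (ltnW k_gt1))).
exact: (ga (Ordinal k_gt1)).
Qed.

(** Injectivity needs only two points at a time; surjectivity then holds
    because the map sends each finite orbit into itself. *)
Lemma locally_in_bijective g : 1 < k -> locally_in k to g -> bijective g.
Proof.
move=> k_gt1 gloc.
have g_inj : injective g.
  move=> x y; have [a [_ -> ->]] := locally_in2 x y k_gt1 gloc.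
  exact: action_inj.
have g_surj y : exists x, g x = y.
  pose gc : {classic Omega} -> {classic Omega} := g.
  pose orb : seq {classic Omega} :=
    undup [seq (to y a : {classic Omega}) | a in G].
  have orbP (z : {classic Omega}) :
      reflect (exists2 a, a \in G & z = to y a) (z \in orb).
    by rewrite /orb mem_undup; apply: imageP.
  have g_orb : {subset [seq gc z | z <- orb] <= orb}.
    move=> _ /mapP[z /orbP[a aG ->] ->]; rewrite /gc.
    have [b bG ->] := locally_in1 (to y a) (ltnW k_gt1) gloc.
    by apply/orbP; exists (a * b); rewrite ?groupM ?actionM.
  have uniq_g : uniq [seq gc z | z <- orb].
    by rewrite map_inj_uniq ?undup_uniq.
  have [|_ g_orbE] := uniq_min_size uniq_g g_orb; first by rewrite size_map.
  have : (y : {classic Omega}) \in orb.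
    by apply/orbP; exists 1; rewrite ?group1 ?action1.
  by rewrite -g_orbE => /mapP[x _ ->]; exists x.
pose f y := sval (cid (g_surj y)).
have fK : cancel f g by move=> y; apply: (svalP (cid (g_surj y))).
by exists f => // x; apply: g_inj; rewrite fK.
Qed.

Lemma k_closure_locally g :
  k_closure k (action_image to) g <-> bijective g /\ locally_in k to g.
Proof.
split=> [[bij_g orb_g] | [bij_g gloc]]; split=> //.
  move=> w; pose t := mktuple w.
  have: tuple_orbit (action_image to) t (map_tuple g t).
    rewrite -orb_g; exists t => //; exists (fun x => to x 1).
      by exists 1 => //=; apply: group1.
    by apply: eq_from_tnth => i; rewrite tnth_map action1.
  case=> _ [a aG <-] ga; exists a => // i.
  have := congr1 (fun u => tnth u i) ga.
  by rewrite !tnth_map tnth_ord_tuple => ->.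
have gtuple (t : k.-tuple Omega) :
    exists2 a, a \in G & map_tuple g t = map_tuple (to^~ a) t.
  have [a aG ga] := gloc (tnth t); exists a => //.
  by apply: eq_from_tnth => i; rewrite !tnth_map.
move=> t; apply/seteqP; split=> [_ [_ [_ [a /= aG <-] <-] <-] | ].
  have [b bG ->] := gtuple (map_tuple (to^~ a) t).
  exists (to^~ (a * b)); first by exists (a * b); rewrite //= groupM.
  by apply: eq_from_tnth => i; rewrite !tnth_map actionM.
move=> _ [_ [a /= aG <-] <-]; have [f gK fK] := bij_g.
(* g moves the preimage under g of the tuple t * a as some b does, so this
   preimage is t * (a * b^-1). *)
pose s := map_tuple f (map_tuple (to^~ a) t).
have gs : map_tuple g s = map_tuple (to^~ a) t.
  by apply: eq_from_tnth => i; rewrite !tnth_map fK.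
exists s => //; have [b bG gb] := gtuple s.
exists (to^~ (a * b^-1)); first by exists (a * b^-1); rewrite //= groupM ?groupV.
apply: eq_from_tnth => i; rewrite tnth_map actionM ?groupV //.
have := congr1 (fun u => tnth u i) gs; rewrite gb [LHS]tnth_map [RHS]tnth_map => <-.
by rewrite actionK.
Qed.

End Local.

Lemma totally_k_closedP (gT : finGroupType) (G : {group gT}) (k : nat) :
  1 < k ->
  totally_k_closed G k <->
  (forall (Omega : Type) (to : action G Omega), faithful_action to ->
     forall g, locally_in k to g -> exists2 a, a \in G & g =1 to^~ a).
Proof.
move=> k_gt1; split=> [clG Omega to ffto g gloc | clG Omega to ffto].
  have : k_closure k (action_image to) g.
    by apply/k_closure_locally; split=> //; apply: locally_in_bijective gloc.
  by rewrite clG // => -[a aG <-]; exists a.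
apply/seteqP; split=> g.
  by case/k_closure_locally=> _ /(clG _ _ ffto)[a aG /funext->]; exists a.
case=> a aG <-; apply/k_closure_locally; split; first exact: action_bijective.
by exists a.
Qed.

Lemma totally_k_closed1 (gT : finGroupType) (k : nat) :
  1 < k -> totally_k_closed [1 gT]%G k.
Proof.
move=> k_gt1; apply/totally_k_closedP => // Omega to _ g gloc.
exists 1 => [|x]; first exact: group1.
by have [a /set1P->] := locally_in1 x (ltnW k_gt1) gloc.
Qed.

(** * Direct products *)

(** The projections of G onto its factors are [remgr H P] and [remgr P H]. The
    P-factor acts on Omega, while the H-factor acts on all of gT by right
    multiplication, where 1 is the only element of H with a fixed point: this
    makes the action of G faithful. An element of G that agrees on Omega with a given map may be replaced by its P-component, which
    acts on Omega in the same way. *)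
Lemma totally_k_closed_factor (gT : finGroupType) (G P H : {group gT}) k :
  1 < k -> P \x H = G -> totally_k_closed G k -> totally_k_closed P k.
Proof.
move=> k_gt1 dG /(totally_k_closedP _ k_gt1) clG.
have [_ defPH _ tiPH] := dprodP dG.
have [_ defHP _ tiHP] := dprodP (etrans (dprodC H P) dG).
have [nsPG nsHG] := dprod_normal2 dG.
have compPH : H \in [complements to P in G] by apply/complP; split.
have compHP : P \in [complements to H in G] by apply/complP; split.
have prP a : a \in G -> remgr H P a \in P by rewrite -defHP; apply: mem_remgr.
apply/totally_k_closedP => // Omega to ffto g gloc.
pose act' (z : Omega + gT) a := match z with
  | inl x => inl (to x (remgr H P a))
  | inr y => inr (y * remgr P H a)
  end.
have act'P : is_action G act'.
  split=> [a [x|x] [y|y] //= [e] | [x|y] a b aG bG /=].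
  - by rewrite (action_inj e).
  - by rewrite (mulIg _ _ _ e).
  - by rewrite (remgrM compHP) // actionM ?prP.
  - by rewrite (remgrM compPH) // mulgA.
pose to' : action G (Omega + gT)%type := Action act'P.
have ffto' : faithful_action to'.
  move=> a aG fix_a.
  have [] := fix_a (inr 1); rewrite mul1g => remPH1.
  have aP : a \in P.
    by rewrite (divgr_eq P H a) remPH1 mulg1 mem_divgr ?defPH.
  apply: ffto => // x; have [] := fix_a (inl x).
  by rewrite (remgr_id tiHP).
pose g' (z : Omega + gT) := if z is inl x then inl (g x) else z.
have [w|b bG g'b] := clG _ to' ffto' g'.
  have [[x0 _]|noP] := pselect (exists x0, exists i, w i = inl x0).
    (* Points of w outside Omega are fixed by P, so they may be replaced by
       any point of Omega when looking for an element of P. *)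
    have [a aP ga] := gloc (fun i => if w i is inl x then x else x0).
    exists a => [|i]; first by rewrite (subsetP (normal_sub nsPG)).
    move: (ga i); case: (w i) => [x|y] /=; first by rewrite (remgr_id tiHP) // => ->.
    by rewrite remgr1 // mulg1.
  exists 1 => // i; rewrite action1; case wi: (w i) => [x|//].
  by case: noP; exists x; exists i.
by exists (remgr H P b) => [|x]; [apply: prP | case: (g'b (inl x))].
Qed.

Section CoprimeProduct.

Variables (gT : finGroupType) (G P H : {group gT}).
Hypotheses (dG : P \x H = G) (coPH : coprime #|P| #|H|).

(** The P-component u of u * v is the power of u * v whose exponent is 1
    modulo #|P| and 0 modulo #|H|, so it fixes every point that u * v fixes. *)
Lemma stab_component (Omega : Type) (to : action G Omega) x u v :
  u \in P -> v \in H -> to x (u * v) = x -> to x u = x.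
Proof.
move=> uP vH fix_uv; have [_ defG cPH _] := dprodP dG.
have uvG : u * v \in G by rewrite -defG mem_mulg.
pose m := chinese #|P| #|H| 1 0.
have -> : u = (u * v) ^+ m.
  have cuv : commute u v by apply/commute_sym/(centsP cPH).
  rewrite expgMn // -(expg_mod m (expg_cardG uP)) chinese_modl //.
  rewrite -(expg_mod m (expg_cardG vH)) chinese_modr // mod0n mulg1.
  by rewrite expg_mod ?expg_cardG.
by elim: m => [|m IHm]; rewrite ?action1 // expgSr actionM ?groupX // IHm.
Qed.

Lemma act_component (Omega : Type) (to : action G Omega) x u v u' v' :
    u \in P -> v \in H -> u' \in P -> v' \in H ->
  to x (u * v) = to x (u' * v') -> to x u = to x u'.
Proof.
move=> uP vH u'P v'H eq_x; have [_ defG cPH _] := dprodP dG.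
have [/normal_sub/subsetP sPG _] := dprod_normal2 dG.
have mulG y z : y \in P -> z \in H -> y * z \in G.
  by move=> yP zH; rewrite -defG mem_mulg.
have uvE : (u * v) * (u' * v')^-1 = (u * u'^-1) * (v * v'^-1).
  have cHP y z : y \in H -> z \in P -> y * z = z * y.
    by move=> yH zP; apply: (centsP cPH).
  rewrite invMg -mulgA (mulgA v) (cHP (v * v'^-1)) ?groupM ?groupV //.
  by rewrite !mulgA.
have fix_x : to x ((u * u'^-1) * (v * v'^-1)) = x.
  by rewrite -uvE actionM ?groupV ?mulG // eq_x actionK ?mulG.
have fix_u : to x (u * u'^-1) = x.
  by apply: stab_component fix_x; rewrite groupM ?groupV.
by rewrite -{2}fix_u -actionM ?groupM ?groupV ?sPG // mulgKV.
Qed.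

(** The P-component of a map g is well defined by [act_component]. An element
    u * v of G that agrees with g on k points has its factor u agreeing with
    the P-component on the same points. *)
Lemma locally_in_component k (Omega : Type) (to : action G Omega) g :
    1 < k -> totally_k_closed P k -> faithful_action to -> locally_in k to g ->
  exists2 a, a \in P & forall x u v, u \in P -> v \in H ->
    g x = to x (u * v) -> to x u = to x a.
Proof.
move=> k_gt1 /(totally_k_closedP _ k_gt1) clP ffto gloc.
have [/normal_sub sPG _] := dprod_normal2 dG.
have comp x : exists y, forall u v, u \in P -> v \in H ->
    g x = to x (u * v) -> to x u = y.
  have [a aG gx] := locally_in1 x (ltnW k_gt1) gloc.
  have [u0 [v0 [u0P v0H a_uv _]]] := mem_dprod dG aG.
  exists (to x u0) => u v uP vH gx'; apply: act_component uP vH u0P v0H _.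
  by rewrite -gx' -a_uv.
pose gP x := sval (cid (comp x)).
have gPE x u v : u \in P -> v \in H -> g x = to x (u * v) -> to x u = gP x.
  exact: (svalP (cid (comp x))).
have [||a aP ga] := clP _ (restrict_action to sPG) _ gP.
- by move=> a aP; apply: ffto; apply: (subsetP sPG).
- move=> w; have [a aG gw] := gloc w.
  have [u [v [uP vH a_uv _]]] := mem_dprod dG aG.
  by exists u => // i; rewrite -(@gPE _ u v) // gw a_uv.
by exists a => // x u v uP vH /gPE-> //; rewrite ga.
Qed.

End CoprimeProduct.

(** If g moves x as u * v does, then a moves x as u does and b moves x as v
    does. Since P and H commute, x is moved by a * b as by u * b = b * u, and
    so as by v * u = u * v. *)
Lemma totally_k_closed_dprod (gT : finGroupType) (G P H : {group gT}) k :
    1 < k -> P \x H = G -> coprime #|P| #|H| ->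
  totally_k_closed P k -> totally_k_closed H k -> totally_k_closed G k.
Proof.
move=> k_gt1 dG coPH clP clH; apply/totally_k_closedP => // Omega to ffto g gloc.
have dG' : H \x P = G by rewrite dprodC.
have coHP : coprime #|H| #|P| by rewrite coprime_sym.
have [_ _ cPH _] := dprodP dG.
have cHP y z : y \in H -> z \in P -> y * z = z * y.
  by move=> yH zP; apply: (centsP cPH).
have [/normal_sub/subsetP sPG /normal_sub/subsetP sHG] := dprod_normal2 dG.
have [a aP ga] := locally_in_component dG coPH k_gt1 clP ffto gloc.
have [b bH gb] := locally_in_component dG' coHP k_gt1 clH ffto gloc.
have [aG bG] := (sPG a aP, sHG b bH).
exists (a * b) => [|x]; first exact: groupM.
have [c cG gx] := locally_in1 x (ltnW k_gt1) gloc.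
have [u [v [uP vH c_uv _]]] := mem_dprod dG cG; rewrite c_uv in gx.
have [uG vG] := (sPG u uP, sHG v vH).
have gx' : g x = to x (v * u) by rewrite (cHP v u vH uP).
rewrite gx' actionM // (gb x v u vH uP gx') -actionM // (cHP b u bH uP).
by rewrite !actionM // (ga x u v uP vH gx).
Qed.

(** * Nilpotent groups *)

Lemma totally_k_closed_nilpotent (k : nat) (gT : finGroupType)
    (G : {group gT}) :
    1 < k -> nilpotent G ->
    (forall p, prime p -> totally_k_closed 'O_p(G)%G k) ->
  totally_k_closed G k.
Proof.
move=> k_gt1; have [n] := ubnP #|G|; elim: n => // n IHn in G * => leGn nilG clG.
have [trivG | ntG] := eqVneq #|G| 1%N.
  suff -> : G = [1 gT]%G by apply: totally_k_closed1.
  by apply/group_inj/card1_trivg.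
pose p := pdiv #|G|.
have p_pr : prime p by rewrite pdiv_prime // ltn_neqAle eq_sym ntG cardG_gt0.
have dG := nilpotent_pcoreC p nilG.
have coPH : coprime #|'O_p(G)| #|'O_p^'(G)|.
  exact: pnat_coprime (pcore_pgroup _ _) (pcore_pgroup _ _).
apply: (totally_k_closed_dprod k_gt1 dG coPH (clG p p_pr)).
apply: IHn => [||q q_pr].
- move: leGn; rewrite ltnS; apply: leq_trans.
  rewrite /= -(dprod_card dG) ltn_Pmull ?cardG_gt0 //.
  rewrite (card_Hall (nilpotent_pcore_Hall p nilG)) p_part_gt1 pi_pdiv.
  by rewrite ltn_neqAle eq_sym ntG cardG_gt0.
- exact: nilpotentS (pcore_sub _ _) nilG.
have [-> | neq_qp] := eqVneq q p.
  suff -> : 'O_p('O_p^'(G))%G = [1 gT]%G by apply: totally_k_closed1.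
  apply/group_inj/card1_trivg; apply: pnat_1 (pcore_pgroup p _) _.
  exact: pgroupS (pcore_sub p _) (pcore_pgroup p^' G).
suff -> : 'O_q('O_p^'(G))%G = 'O_q(G)%G by apply: clG.
apply: group_inj; rewrite /= -pcoreI; apply: eq_pcore => r.
by rewrite !inE; case: eqP => //= ->.
Qed.

Theorem theoremA (k : nat) (hk : 2 <= k) (gT : finGroupType) (G : {group gT})
    (nilG : nilpotent G) :
  totally_k_closed G k <->
  (forall (p : nat) (P : {group gT}),
     prime p -> (p.-Sylow(G) P)%g -> totally_k_closed P k).
Proof.
split=> [clG p P _ sylP | clSyl].
  have -> : P = 'O_p(G)%G by apply: group_inj; apply: nilpotent_Hall_pcore.
  exact: totally_k_closed_factor (nilpotent_pcoreC p nilG) clG.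
apply: totally_k_closed_nilpotent => // p p_pr.
exact: clSyl p_pr (nilpotent_pcore_Hall p nilG).
Qed.
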